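(* Let $A=\mathbb{Z}[x_1,\dots,x_n]$, and let $I$ and $J$ be ideals of $A$ such that $J\subset I$. Let $m$ be the exponent of the torsion part of the abelian group $A/J$, i.e., $m$ is the minimal positive integer such that $m(\mathbb{Q}J\cap A)\subset J$. Let $m_1,\dots,m_t$ be pairwise coprime integers whose product is equal to $m$. Suppose that (i) $\mathbb{Q}J=\mathbb{Q}I$, i.e., $I$ and $J$ generate the same ideal in $\mathbb{Q}[x_1,\dots,x_n]$; and (ii) $\iota_{\mathbb{Z}/m_i\mathbb{Z}}(J)=\iota_{\mathbb{Z}/m_i\mathbb{Z}}(I)$ for every $i=1,\dots,t$. Then $I=J$.
   Context: The ring $A=\mathbb{Z}[x_1,\dots,x_n]$ is regarded as a subset of $\mathbb{Q}[x_1,\dots,x_n]$. For an ideal $I$ of $A$, $\mathbb{Q}I$ denotes the ideal of $\mathbb{Q}[x_1,\dots,x_n]$ generated by $I$. For a ring $R$, $\iota_R: A\to A\otimes_{\mathbb{Z}} R=R[x_1,\dots,x_n]$ denotes the natural mapping; in particular, $\iota_{\mathbb{Z}/k\mathbb{Z}}$ is reduction of coefficients modulo $k$, and $\iota_{\mathbb{Z}/k\mathbb{Z}}(I)$ is the image of $I$ in $(\mathbb{Z}/k\mathbb{Z})[x_1,\dots,x_n]$. *)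

(* Defs.v *)
From HB Require Import structures.
From mathcomp Require Import all_boot all_order all_algebra.
From mathcomp Require Import boolp classical_sets.
From mathcomp.multinomials Require Import mpoly.

Set Implicit Arguments.
Unset Strict Implicit.
Unset Printing Implicit Defensive.

Import GRing.Theory.

Local Open Scope classical_set_scope.
Local Open Scope ring_scope.

(* MathComp's [idealr] only covers proper ideals with decidable membership,
   whereas the ideals here are arbitrary; hence a predicate on [set R].
   Closure under opposites follows from closure under multiplication. *)
Record is_ideal (R : comNzRingType) (I : set R) : Prop := IsIdeal {
  ideal0 : I 0;
  idealD : forall x y, I x -> I y -> I (x + y);
  idealM : forall a x, I x -> I (a * x)
}.

Definition ideal_gen (R : comNzRingType) (S : set R) : set R :=
  smallest (@is_ideal R) S.

Definition iota_mpoly (n : nat) (R : nzRingType) (f : {mpoly int[n]}) :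
    {mpoly R[n]} :=
  map_mpoly (intr : int -> R) f.

Definition QI (n : nat) (I : set {mpoly int[n]}) : set {mpoly rat[n]} :=
  ideal_gen (iota_mpoly rat @` I).

(* m (QI J `&` A) is contained in J, the intersection being taken through the
   embedding of A = Z[x_1, .., x_n] in Q[x_1, .., x_n]. *)
Definition kills_torsion (n : nat) (J : set {mpoly int[n]}) (m : nat) : Prop :=
  [set f *+ m | f in iota_mpoly rat @^-1` QI J] `<=` J.

Definition is_torsion_exponent (n : nat) (J : set {mpoly int[n]}) (m : nat) :
    Prop :=
  [/\ (0 < m)%N, kills_torsion J m &
      forall k : nat, (0 < k)%N -> kills_torsion J k -> (m <= k)%N].

(* The images of J and I in (Z/kZ)[x_1, .., x_n] are equal. The ring 'Z_k is
   Z/kZ only for k >= 2, and [{mpoly R[n]}] needs a nontrivial ring R, so the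
   other values of |k| are separate: Z/0Z is Z, and (Z/1Z)[x_1, .., x_n] is the
   zero ring, in which the images of any two ideals are equal. *)
Definition same_image_mod (n : nat) (k : int) (J I : set {mpoly int[n]}) :
    Prop :=
  match `|k|%N with
  | 0 => iota_mpoly int @` J = iota_mpoly int @` I
  | 1 => True
  | k'.+2 => iota_mpoly 'Z_k'.+2 @` J = iota_mpoly 'Z_k'.+2 @` I
  end.

(* Main.v *)
Require Import Defs.
From HB Require Import structures.
From mathcomp Require Import all_boot all_order all_algebra.
From mathcomp Require Import boolp classical_sets.
From mathcomp.multinomials Require Import mpoly.

Set Implicit Arguments.
Unset Strict Implicit.
Unset Printing Implicit Defensive.

Import GRing.Theory.

Local Open Scope classical_set_scope.
Local Open Scope ring_scope.

(** Let [f] be in [I]. The integers [k] with [k f] in [J] form an ideal of Z,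
    and the claim is that it contains 1.

    It contains [m]: [f] lies in [QI J], since [QI J = QI I], so the torsion
    exponent [m] sends [f] into [J].
    It also contains every cofactor [m / m_i]: by the congruence hypothesis
    [f = g + m_i h] with [g] in [J]; then [m_i h = f - g] lies in [I], and since
    [m_i] is invertible in Q, [h] lies in [QI I = QI J].  Hence [m h] is in [J],
    and so is [(m / m_i) f = (m / m_i) g + m h].
    The [m_i] being pairwise coprime, the cofactors and [m] generate the unit
    ideal of Z ([cofactors_generate_1]). *)

Lemma idealMz (R : comNzRingType) (J : set R) (k : int) (x : R) :
  is_ideal J -> J x -> J (x *~ k).
Proof. by move=> idJ Jx; rewrite -mulrzl; exact: idealM. Qed.

Lemma idealB (R : comNzRingType) (J : set R) (x y : R) :
  is_ideal J -> J x -> J y -> J (x - y).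
Proof.
by move=> idJ Jx Jy; rewrite -mulN1r; apply: idealD => //; exact: idealM.
Qed.

Lemma colon_ideal (R : comNzRingType) (J : set R) (x : R) :
  is_ideal J -> is_ideal [set k : int | J (x *~ k)].
Proof.
move=> idJ; split => /= [|k l Jk Jl|a k Jk].
- by rewrite mulr0z; exact: ideal0.
- by rewrite mulrzDr; exact: idealD.
- by rewrite mulrC mulrzA; exact: idealMz.
Qed.

(** If [b c] and [a c] are in [L] and [a], [b] are coprime then [c] is in [L].
    This removes the factors of [\prod_i c_i] one at a time: to remove [c_i] from
    the product [c_i P] that is left, compare it with the cofactor of [c_i], which
    is [P] times factors that were removed before and are coprime to [c_i]. *)
Lemma cofactors_generate_1 (T : finType) (c : T -> int) (L : set int) :
  is_ideal L ->
  (forall i j, i != j -> coprimez (c i) (c j)) ->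
  L (\prod_i c i) ->
  (forall i, L (\prod_(j | j != i) c j)) ->
  L 1.
Proof.
move=> idL co_c Lprod Lcof.
suff Lcompl (r : seq T) : uniq r -> L (\prod_(j | j \notin r) c j).
  have := Lcompl _ (enum_uniq T); rewrite big_pred0 // => j.
  by rewrite mem_enum inE.
elim: r => [_|i r IHr /= /andP[i_r uniq_r]].
  by rewrite (eq_bigl xpredT).
have := IHr uniq_r; rewrite (bigD1 i) //=.
set P := \prod_(j | _) _ => LciP.
have PE : \prod_(j | j \notin i :: r) c j = P.
  by apply: eq_bigl => j; rewrite in_cons negb_or andbC.
rewrite PE; have := Lcof i; rewrite (bigID (mem r)) /=.
have -> : \prod_(j | (j != i) && (j \notin r)) c j = P.
  by apply: eq_bigl => j; rewrite andbC.
set Q := \prod_(j | _) _ => LQP.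
have /coprimezP[[u v] /= uv1] : coprimez (c i) Q.
  rewrite /Q; elim/big_ind: _ => [|x y cx cy|j /andP[ji _]].
  - by rewrite /coprimez gcdz1.
  - by rewrite coprimezMr cx.
  - by apply: co_c; rewrite eq_sym.
rewrite -[P]mul1r -uv1 mulrDl -!mulrA.
by apply: idealD => //; apply: idealM.
Qed.

Lemma ideal_gen_ideal (R : comNzRingType) (S : set R) :
  is_ideal (ideal_gen S).
Proof.
split.
- by move=> K [idK _]; exact: ideal0.
- by move=> x y Sx Sy K [idK SK]; apply: idealD => //; [exact: Sx|exact: Sy].
- by move=> a x Sx K [idK SK]; apply: idealM => //; exact: Sx.
Qed.

Lemma QI_saturated (n : nat) (I : set {mpoly int[n]}) (h : {mpoly int[n]})
    (k : int) :
  k != 0 -> I (h *~ k) -> QI I (iota_mpoly rat h).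
Proof.
move=> k0 Ihk.
have -> : iota_mpoly rat h = (k%:~R^-1)%:MP * iota_mpoly rat (h *~ k).
  rewrite /iota_mpoly raddfMz -scaler_int mul_mpolyC scalerA mulVf ?scale1r //.
  by rewrite intr_eq0.
apply: (idealM (ideal_gen_ideal _)).
by apply: sub_gen_smallest; exists (h *~ k).
Qed.

Lemma mpoly_divz (n : nat) (p : {mpoly int[n]}) (k : int) :
  (forall e, (k %| p@_e)%Z) -> exists h, p = h *~ k.
Proof.
move=> kp; exists (\sum_(e <- msupp p) (p@_e %/ k)%Z *: 'X_[e]).
rewrite {1}(mpolyE p) mulrz_suml; apply: eq_bigr => e _.
by rewrite scalerMzl -mulrzr intz divzK.
Qed.

Lemma Zp_intr_eq0 (k : nat) (a : int) :
  (a%:~R == 0 :> 'Z_k.+2) = (k.+2%:Z %| a)%Z.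
Proof.
have natE (b : nat) : (b%:R == 0 :> 'Z_k.+2) = (k.+2 %| b)%N.
  by rewrite -val_eqE /= val_Zp_nat.
by case: a => b; rewrite ?NegzE ?mulrNz ?oppr_eq0 ?dvdzN natE.
Qed.

(** The congruence hypothesis lifted to Z.  Uniformly in [k] it says that
    I is contained in [J + k A]: for [k = 0] the reduction is injective, and for
    [k] a unit every polynomial is a multiple of [k]. *)
Lemma same_image_mod_split (n : nat) (k : int) (J I : set {mpoly int[n]})
    (f : {mpoly int[n]}) :
  is_ideal J -> same_image_mod k J I -> I f ->
  exists g h, J g /\ f = g + h *~ k.
Proof.
move=> idJ; rewrite /same_image_mod.
case kE: `|k|%N => [|[|k']] JI If.
- have: (iota_mpoly int @` I) (iota_mpoly int f) by exists f.
  rewrite -JI => -[g Jg gf]; exists g, 0; split=> //.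
  rewrite mul0rz addr0; apply/mpolyP => e.
  by have := congr1 (mcoeff e) gf; rewrite !mcoeff_map_mpoly /= !intz.
- exists 0, (f *~ k); split; first exact: ideal0.
  (* [k] is 1 or -1, hence its own inverse. *)
  by rewrite add0r -mulrzA -expr2 -Num.Theory.real_normK ?Num.Theory.num_real //
            -abszE kE.
- have: (iota_mpoly 'Z_k'.+2 @` I) (iota_mpoly 'Z_k'.+2 f) by exists f.
  rewrite -JI => -[g Jg gf].
  have [e|h fgh] := @mpoly_divz n (f - g) k.
    have -> : (k %| (f - g)@_e)%Z = (k'.+2%:Z %| (f - g)@_e)%Z.
      by rewrite !dvdzE kE.
    rewrite -Zp_intr_eq0 mcoeffB rmorphB subr_eq0 /=.
    have := congr1 (mcoeff e) gf; rewrite !mcoeff_map_mpoly /= => ->.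
    exact: eqxx.
  by exists g, h; split=> //; rewrite -fgh addrC subrK.
Qed.

Theorem mainTheorem1 (n : nat) (I J : set {mpoly int[n]})
    (idealI : is_ideal I) (idealJ : is_ideal J) (JI : J `<=` I)
    (m : nat) (m_exponent : is_torsion_exponent J m)
    (t : nat) (ms : 'I_t -> int)
    (ms_coprime : forall i j : 'I_t, i != j -> coprimez (ms i) (ms j))
    (ms_prod : \prod_(i < t) ms i = m%:Z)
    (QJ_QI : QI J = QI I)
    (J_I_mod : forall i : 'I_t, same_image_mod (ms i) J I) :
  I = J.
Proof.
have [m_gt0 mJ _] := m_exponent.
have killed h k : k != 0 -> I (h *~ k) -> J (h *~ m%:Z).
  move=> k0 Ihk; apply: mJ; exists h => //.
  by rewrite /preimage /= QJ_QI; exact: (QI_saturated k0).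
apply/seteqP; split=> // f If.
rewrite -[f]mulr1z.
apply: (cofactors_generate_1 (colon_ideal f idealJ) ms_coprime) => [|i] /=.
  by rewrite ms_prod; apply: (killed f 1).
have [g [h [Jg fE]]] := same_image_mod_split idealJ (J_I_mod i) If.
have ms_mul : ms i * \prod_(j | j != i) ms j = m%:Z.
  by rewrite -ms_prod [RHS](bigD1 i).
have ms_neq0 : ms i != 0.
  by apply: contraTneq m_gt0 => ms0; move: ms_mul; rewrite ms0 mul0r => -[<-].
rewrite fE mulrzDl -mulrzA ms_mul; apply: idealD => //; first exact: idealMz.
apply: (killed h (ms i)) => //.
have -> : h *~ ms i = f - g by rewrite fE addrAC subrr add0r.
by apply: idealB => //; exact: JI.
Qed.
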